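(* Let $H$ be a real Hilbert space, suppose that $A$ generates a linear $C_0$-semigroup of isometries $S_0(t)$ on $H$, and let $B:H\to H$ be a (possibly nonlinear) Lipschitz operator with $B(0)=0$. If the system $$\frac{dz(t)}{dt}=Az(t)+v(t)Bz(t),\qquad z(0)=z_0,$$ is uniformly exponentially stabilizable with a constant control, then there exist $T,\delta>0$ such that $$\int_0^T\|BS_0(t)y\|\,dt\ \ge\ \delta\|y\|,\qquad \forall y\in H.$$
   Context: $H$ is a real Hilbert space with norm $\|\cdot\|$. The system is uniformly exponentially stabilizable with a constant control if there exists a constant $c\in\mathbb{R}$ such that, with $v(t)\equiv c$, for each $z_0\in H$ there is a unique mild solution $z(t)$ defined for all $t\ge0$ (i.e. a continuous $z:[0,\infty)\to H$ with $z(t)=S_0(t)z_0+c\int_0^tS_0(t-s)Bz(s)\,ds$), and there exist $M,\sigma>0$ independent of $z_0$ such that $\|z(t)\|\le Me^{-\sigma t}\|z_0\|$ for all $t\ge 0$ and all $z_0\in H$. *)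

(* Defs.v *)
From Stdlib Require Import Reals.
From Coquelicot Require Import Coquelicot.
Open Scope R_scope.

(* A real Hilbert space is a complete normed real vector space whose norm is
   the one given by an inner product. *)
Record is_hilbert_inner {H : CompleteNormedModule R_AbsRing}
    (inner : H -> H -> R) : Prop := {
  inner_sym : forall x y : H, inner x y = inner y x;
  inner_plus_l : forall x y w : H, inner (plus x y) w = inner x w + inner y w;
  inner_scal_l : forall (a : R) (x y : H), inner (scal a x) y = a * inner x y;
  inner_pos : forall x : H, 0 <= inner x x;
  inner_def : forall x : H, inner x x = 0 -> x = zero;
  norm_inner : forall x : H, norm x = sqrt (inner x x)
}.

(* Time is all of [R], but only the values [S t] with [0 <= t] are constrained
   or used.  [is_linear] includes boundedness. *)
Record is_C0_semigroup {H : CompleteNormedModule R_AbsRing}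
    (S : R -> H -> H) : Prop := {
  semigroup_linear : forall t : R, 0 <= t -> is_linear (S t);
  semigroup_0 : forall x : H, S 0 x = x;
  semigroup_plus : forall (s t : R) (x : H),
    0 <= s -> 0 <= t -> S (s + t) x = S s (S t x);
  semigroup_continuous : forall x : H,
    filterlim (fun t => S t x) (at_right 0) (locally x)
}.

Definition is_isometric_family {H : CompleteNormedModule R_AbsRing}
    (S : R -> H -> H) : Prop :=
  forall (t : R) (x : H), 0 <= t -> norm (S t x) = norm x.

(* The generator is a possibly unbounded operator [A] with domain [D], where [D]
   consists of exactly those [x] for which [(S t x - x) / t] converges as
   [t -> 0+]. *)
Definition is_generator {H : CompleteNormedModule R_AbsRing}
    (D : H -> Prop) (A : {x : H | D x} -> H) (S : R -> H -> H) : Prop :=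
  (forall x : H, D x <->
     exists y : H,
       filterlim (fun t => scal (/ t) (minus (S t x) x)) (at_right 0) (locally y))
  /\
  (forall x : {x : H | D x},
     filterlim (fun t => scal (/ t) (minus (S t (proj1_sig x)) (proj1_sig x)))
       (at_right 0) (locally (A x))).

Definition is_lipschitz {H : CompleteNormedModule R_AbsRing}
    (B : H -> H) : Prop :=
  exists L : R, 0 <= L /\
    forall x y : H, norm (minus (B x) (B y)) <= L * norm (minus x y).

(* Mild solution on [0, +oo) of [z' = A z + c B z], [z 0 = z0], where [S] is the
   semigroup generated by [A].  Values of [z] at negative times are irrelevant. *)
Definition is_mild_solution {H : CompleteNormedModule R_AbsRing}
    (S : R -> H -> H) (B : H -> H) (c : R) (z0 : H) (z : R -> H) : Prop :=
  continuous_on (fun t => 0 <= t) z /\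
  forall t : R, 0 <= t ->
    ex_RInt (fun s => S (t - s) (B (z s))) 0 t /\
    z t = plus (S t z0) (scal c (RInt (fun s => S (t - s) (B (z s))) 0 t)).

Definition unif_exp_stabilizable_const {H : CompleteNormedModule R_AbsRing}
    (S : R -> H -> H) (B : H -> H) : Prop :=
  exists c : R,
    (forall z0 : H, exists z : R -> H,
       is_mild_solution S B c z0 z /\
       forall z' : R -> H, is_mild_solution S B c z0 z' ->
         forall t : R, 0 <= t -> z' t = z t) /\
    exists M sigma : R, 0 < M /\ 0 < sigma /\
      forall (z0 : H) (z : R -> H), is_mild_solution S B c z0 z ->
        forall t : R, 0 <= t -> norm (z t) <= M * exp (- sigma * t) * norm z0.

(* Main.v *)
(** Compare the mild solution [z] starting at [y] under the stabilizing control
    [c] with the free orbit [S0 t y].  Since [S0] is isometric, the distance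
    [g t = |z t - S0 t y|] satisfies
    [g t <= |c| * int_0^t (|B (S0 s y)| + L * g s) ds], so Gronwall gives
    [g T <= |c| * exp (|c| * L * T) * int_0^T |B (S0 s y)| ds].  For [T] large
    [|z T| <= |y| / 2] while [|S0 T y| = |y|], hence [g T >= |y| / 2]. *)

Require Import Defs.
From Stdlib Require Import Reals Lra.
From Coquelicot Require Import Coquelicot.
Open Scope R_scope.

(** The function [f t = exp (- K t) * (F + K * int_0^t g)] is nonincreasing on [[0, T]]: its
    derivative is [K * exp (- K t)] times [g t - (F + K * int_0^t g)], which the hypothesis makes
    nonpositive. No sign condition on [g] or [F] enters. Continuity of [g] on all of [R] makes [f]
    differentiable at the endpoints too. *)
Lemma gronwall (g : R -> R) (F K T : R) :
  0 <= T -> 0 <= K -> (forall t, continuous g t) ->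
  (forall t, 0 <= t <= T -> g t <= F + K * RInt g 0 t) ->
  g T <= F * exp (K * T).
Proof.
  intros HT HK Hc Hg.
  assert (Hex : forall a b, ex_RInt g a b)
    by (intros a b; apply (ex_RInt_continuous g); auto).
  pose (f := fun t => exp (- (K * t)) * (F + K * RInt g 0 t)).
  pose (df := fun t => exp (- (K * t)) * (K * (g t - (F + K * RInt g 0 t)))).
  assert (HG : forall t, is_derive (fun t => RInt g 0 t) t (g t)).
  { intros t. apply (is_derive_RInt g _ 0); auto.
    apply filter_forall; intros u. apply (RInt_correct g); auto. }
  assert (Hf : forall t, is_derive f t (df t)).
  { intros t. unfold f, df. specialize (HG t).
    set (G := fun t : R => RInt g 0 t : R) in HG.
    change (is_derive (fun s => exp (- (K * s)) * (F + K * G s)) t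
              (exp (- (K * t)) * (K * (g t - (F + K * G t))))).
    clearbody G. auto_derive.
    - exists (g t); exact HG.
    - replace (Derive (fun x : R => G x) t) with (g t)
        by (symmetry; apply is_derive_unique, HG).
      ring. }
  (* By the mean value theorem, [f T - f 0 = df x * (T - 0)] for some [x] in [[0, T]], so
     [df x <= 0] yields [f T <= f 0 = F]. *)
  destruct (MVT_gen f 0 T df) as [x [Hx E]].
  { auto. }
  { intros x _. apply continuity_pt_filterlim, (ex_derive_continuous f).
    exists (df x); auto. }
  rewrite Rmin_left, Rmax_right in Hx by assumption.
  assert (Hdf : df x <= 0).
  { unfold df. specialize (Hg x Hx). pose proof (exp_pos (- (K * x))).
    assert (0 <= exp (- (K * x)) * (K * (F + K * RInt g 0 x - g x))).
    { apply Rmult_le_pos; [lra|]. apply Rmult_le_pos; lra. }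
    nra. }
  assert (HfT : f T <= F).
  { assert (f 0 = F).
    { unfold f. rewrite RInt_point. unfold zero; simpl.
      rewrite !Rmult_0_r, Ropp_0, exp_0. ring. }
    assert (df x * (T - 0) <= 0) by nra. lra. }
  apply Rle_trans with (F + K * RInt g 0 T); [apply Hg; lra|].
  unfold f in HfT.
  replace (F + K * RInt g 0 T)
    with (exp (- (K * T)) * (F + K * RInt g 0 T) * exp (K * T)).
  - apply Rmult_le_compat_r; [apply Rlt_le, exp_pos|assumption].
  - rewrite exp_Ropp. field. apply Rgt_not_eq, exp_pos.
Qed.

Lemma minus_plus_l (G : AbelianGroup) (x y : G) : minus (plus x y) x = y.
Proof.
  unfold minus. rewrite (plus_comm x), <- plus_assoc.
  etransitivity; [exact (f_equal (plus y) (plus_opp_r x))|apply plus_zero_r].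
Qed.

Lemma norm_minus_ge (H : CompleteNormedModule R_AbsRing) (x y : H) :
  norm x - norm y <= norm (minus x y).
Proof.
  eapply Rle_trans; [apply Rle_abs|apply (norm_triangle_inv (V := H))].
Qed.

Lemma is_lipschitz_continuous (H : CompleteNormedModule R_AbsRing)
  (B : H -> H) (x : H) : is_lipschitz B -> continuous B x.
Proof.
  intros [L [HL HB]].
  apply (filterlim_locally_ball_norm (F := locally x) B (B x)).
  intros eps.
  (* [L + 1] keeps the denominator positive when [L = 0]. *)
  assert (Hd : 0 < eps / (L + 1)) by (apply Rdiv_lt_0_compat; [apply eps|lra]).
  apply (locally_le_locally_norm x).
  exists (mkposreal _ Hd). intros y Hy. unfold ball_norm in *; simpl in Hy.
  apply Rle_lt_trans with (1 := HB y x).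
  apply Rle_lt_trans with ((L + 1) * norm (minus y x)).
  - apply Rmult_le_compat_r; [apply norm_ge_0|lra].
  - replace (pos eps) with ((L + 1) * (eps / (L + 1))) by (field; lra).
    apply Rmult_lt_compat_l; [lra|assumption].
Qed.

Lemma Rmax_0_dist (s t : R) : Rabs (Rmax 0 s - Rmax 0 t) <= Rabs (s - t).
Proof.
  unfold Rmax. destruct (Rle_dec 0 s), (Rle_dec 0 t);
    unfold Rabs; repeat destruct Rcase_abs; lra.
Qed.

(* Precomposing with [Rmax 0] turns continuity on [0, +oo) into continuity on [R]. *)
Lemma continuous_on_Rmax_0 (H : CompleteNormedModule R_AbsRing) (z : R -> H) :
  continuous_on (fun t => 0 <= t) z ->
  forall t, continuous (fun t => z (Rmax 0 t)) t.
Proof.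
  intros Hz t P HP.
  destruct (Hz (Rmax 0 t) (Rmax_l 0 t) P HP) as [d Hd].
  exists d. intros s Hs. apply Hd; [|apply Rmax_l].
  apply Rle_lt_trans with (2 := Hs), Rmax_0_dist.
Qed.

Section IsometricSemigroup.

Context (H : CompleteNormedModule R_AbsRing) (S : R -> H -> H).
Hypotheses (HS : is_C0_semigroup S) (Hiso : is_isometric_family S).

(** For [s <= t], [S t x - S s x = S s (S (t - s) x - x)], and [S s] preserves norms. Continuity of
    an orbit at any time, from both sides, thus reduces to right continuity at [0]. *)
Lemma norm_orbit_minus (s t : R) (x : H) : 0 <= s -> 0 <= t ->
  norm (minus (S s x) (S t x)) = norm (minus (S (Rabs (s - t)) x) x).
Proof.
  assert (Hle : forall s t, 0 <= s <= t ->
    norm (minus (S t x) (S s x)) = norm (minus (S (t - s) x) x)).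
  { intros s' t' Hst.
    replace (S t' x) with (S s' (S (t' - s') x))
      by (rewrite <- (semigroup_plus S HS) by lra; f_equal; ring).
    rewrite <- (linear_minus (S s')) by (apply (semigroup_linear S HS); lra).
    apply Hiso; lra. }
  intros Hs Ht. destruct (Rle_dec s t) as [Hst|Hst].
  - rewrite <- norm_opp, opp_minus, Hle by lra.
    rewrite Rabs_left1 by lra. do 3 f_equal; ring.
  - rewrite Hle by lra. now rewrite Rabs_pos_eq by lra.
Qed.

Lemma continuous_on_orbit (x : H) :
  continuous_on (fun t => 0 <= t) (fun t => S t x).
Proof.
  intros t Ht.
  apply (filterlim_locally_ball_norm (F := within (fun t => 0 <= t) (locally t))
           (fun t => S t x) (S t x)).
  intros eps.
  pose proof (proj1 (filterlim_locally_ball_norm (F := at_right 0) (fun t => S t x) x)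
           (semigroup_continuous S HS x) eps) as [d Hd].
  exists d. intros s Hs Hs0. unfold ball_norm in *.
  rewrite norm_orbit_minus by assumption.
  (* [at_right 0] says nothing about the point [0] itself, so [s = t] is treated apart. *)
  destruct (Req_dec (Rabs (s - t)) 0) as [->|Hne].
  - rewrite (semigroup_0 S HS), minus_eq_zero.
    apply Rle_lt_trans with 0; [apply Req_le, (norm_zero (V := H))|apply eps].
  - pose proof (Rabs_pos (s - t)). apply Hd; [|lra].
    change (Rabs (Rabs (s - t) - 0) < d).
    rewrite Rminus_0_r, Rabs_Rabsolu. exact Hs.
Qed.

Lemma mild_solution_deviation (B : H -> H) (L c T : R) (y : H) (z : R -> H) :
  0 <= L -> (forall x y, norm (minus (B x) (B y)) <= L * norm (minus x y)) ->
  0 <= T -> is_mild_solution S B c y z ->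
  ex_RInt (fun t => norm (B (S t y))) 0 T /\
  norm (minus (z T) (S T y)) <=
    Rabs c * RInt (fun t => norm (B (S t y))) 0 T * exp (Rabs c * L * T).
Proof.
  intros HL HB HT [Hzc Hz].
  assert (HBc : forall x, continuous B x)
    by (intros x; apply is_lipschitz_continuous; exists L; auto).
  (* [u] and [w] freeze the free orbit and the mild solution at their initial values for negative
     times. They are continuous on [R], and integrals over [[0, T]] are unchanged. *)
  pose (u := fun t => S (Rmax 0 t) y).
  pose (w := fun t => z (Rmax 0 t)).
  pose (phi := fun t => norm (B (u t))).
  pose (g := fun t => norm (minus (w t) (u t))).
  assert (Hu : forall t, continuous u t)
    by apply (continuous_on_Rmax_0 H _ (continuous_on_orbit y)).
  assert (Hw : forall t, continuous w t)
    by apply (continuous_on_Rmax_0 H _ Hzc).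
  assert (Hphi : forall t, continuous phi t).
  { intros t. apply (continuous_comp (fun t => B (u t)) norm).
    - apply (continuous_comp u B); auto.
    - apply (filterlim_norm (B (u t))). }
  assert (Hg : forall t, continuous g t).
  { intros t. apply (continuous_comp (fun t => minus (w t) (u t)) norm).
    - apply (continuous_minus w u); auto.
    - apply (filterlim_norm (minus (w t) (u t))). }
  assert (Iphi : forall a b, ex_RInt phi a b)
    by (intros; apply (ex_RInt_continuous phi); auto).
  assert (Ig : forall a b, ex_RInt g a b)
    by (intros; apply (ex_RInt_continuous g); auto).
  assert (Ephi : forall t, Rmin 0 T < t < Rmax 0 T -> phi t = norm (B (S t y))).
  { intros t. rewrite Rmin_left by assumption. intros Ht.
    unfold phi, u. now rewrite Rmax_right by lra. }
  split.
  { apply (ex_RInt_ext phi); auto. }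
  rewrite <- (RInt_ext phi) by exact Ephi.
  replace (norm (minus (z T) (S T y))) with (g T)
    by (unfold g, w, u; now rewrite Rmax_right by assumption).
  (* Here [F = |c| * int_0^T phi] and [K = |c| * L]. *)
  apply gronwall; auto.
  { apply Rmult_le_pos; [apply Rabs_pos|assumption]. }
  intros t Ht. unfold g at 1, w, u. rewrite Rmax_right by lra.
  destruct (Hz t (proj1 Ht)) as [Hex ->].
  replace (minus (plus (S t y)
      (scal c (RInt (fun s => S (t - s) (B (z s))) 0 t))) (S t y))
    with (scal c (RInt (fun s => S (t - s) (B (z s))) 0 t)).
  2: { symmetry; apply (minus_plus_l H). }
  eapply Rle_trans; [apply (norm_scal (V := H) c)|].
  (* The isometry [S (t - s)] drops out of the norm, and the Lipschitz bound gives [|B (z s)| <= |B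
     (S s y)| + L * |z s - S s y|]. *)
  assert (Hn : norm (RInt (fun s => S (t - s) (B (z s))) 0 t)
               <= RInt phi 0 t + L * RInt g 0 t).
  { apply (norm_RInt_le (fun s => S (t - s) (B (z s)))
             (fun s => plus (phi s) (scal L (g s))) 0 t).
    - lra.
    - intros s Hs. rewrite Hiso by lra.
      unfold phi, g, u, w. rewrite Rmax_right by lra.
      unfold plus, scal; simpl; unfold mult; simpl.
      rewrite Rplus_comm; apply Rle_minus_l, Rle_trans with (2 := HB _ _).
      apply norm_minus_ge.
    - apply RInt_correct, Hex.
    - apply (is_RInt_plus phi (fun s => scal L (g s))).
      + apply (RInt_correct phi); auto.
      + apply (is_RInt_scal g). apply (RInt_correct g); auto. }
  (* Gronwall needs an [F] independent of [t]; since [phi >= 0], the integral may be extended to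
     [T]. *)
  assert (Hp : RInt phi 0 t <= RInt phi 0 T).
  { rewrite <- (RInt_Chasles phi 0 t T) by auto.
    assert (0 <= RInt phi t T)
      by (apply RInt_ge_0; [lra|auto|intros; apply norm_ge_0]).
    unfold plus; simpl; lra. }
  change (abs c) with (Rabs c).
  pose proof (Rabs_pos c).
  apply Rle_trans with (Rabs c * (RInt phi 0 T + L * RInt g 0 t)).
  - apply Rmult_le_compat_l; lra.
  - apply Req_le; ring.
Qed.

End IsometricSemigroup.

Lemma exp_decay_le_half (M sigma : R) : 0 < M -> 0 < sigma ->
  exists T, 0 < T /\ M * exp (- sigma * T) <= / 2.
Proof.
  (* With this [T] the claim reads [M * exp (- 2 M) <= 1/2], which follows from
     [2 M < 1 + 2 M < exp (2 M)]. *)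
  intros HM Hs. exists (2 * M / sigma).
  split; [apply Rdiv_lt_0_compat; lra|].
  replace (- sigma * (2 * M / sigma)) with (- (2 * M)) by (field; lra).
  rewrite exp_Ropp.
  pose proof (exp_ineq1 (2 * M)).
  apply Rmult_le_reg_r with (exp (2 * M)); [apply exp_pos|].
  rewrite Rmult_assoc, Rinv_l by (apply Rgt_not_eq, exp_pos). lra.
Qed.

Theorem theorem9
  (H : CompleteNormedModule R_AbsRing)
  (inner : H -> H -> R) (Hinner : is_hilbert_inner inner)
  (D : H -> Prop) (A : {x : H | D x} -> H) (S0 : R -> H -> H)
  (HS : is_C0_semigroup S0) (Hiso : is_isometric_family S0)
  (HA : is_generator D A S0)
  (B : H -> H) (HB : is_lipschitz B) (HB0 : B zero = zero)
  (Hstab : unif_exp_stabilizable_const S0 B) :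
  exists T delta : R, 0 < T /\ 0 < delta /\
    forall y : H,
      ex_RInt (fun t => norm (B (S0 t y))) 0 T /\
      RInt (fun t => norm (B (S0 t y))) 0 T >= delta * norm y.
Proof.
  destruct HB as [L [HL HB]].
  destruct Hstab as [c [Hex [M [sigma [HM [Hs Hdecay]]]]]].
  destruct (exp_decay_le_half M sigma HM Hs) as [T [HT HMT]].
  (* [Rabs c + 1] instead of [Rabs c] covers [c = 0]. *)
  pose (C := (Rabs c + 1) * exp (Rabs c * L * T)).
  assert (HC : 0 < C).
  { apply Rmult_lt_0_compat; [pose proof (Rabs_pos c); lra|apply exp_pos]. }
  (* This [delta] comes from [|y| / 2 <= |y| - |z T| <= |z T - S0 T y| <= C * I], where [I] is the
     integral to be bounded below. *)
  exists T, (/ (2 * C)).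
  split; [exact HT|]. split; [apply Rinv_0_lt_compat; lra|].
  intros y. destruct (Hex y) as [z [Hz _]].
  destruct (mild_solution_deviation H S0 HS Hiso B L c T y z)
    as [Hint Hdev]; auto; [lra|].
  split; [exact Hint|].
  set (I := RInt (fun t => norm (B (S0 t y))) 0 T) in *.
  assert (HI : 0 <= I)
    by (apply RInt_ge_0; [lra|exact Hint|intros; apply norm_ge_0]).
  assert (HzT : norm (z T) <= / 2 * norm y).
  { apply Rle_trans with (1 := Hdecay y z Hz T (Rlt_le _ _ HT)).
    apply Rmult_le_compat_r; [apply norm_ge_0|exact HMT]. }
  assert (Hlow : norm y - norm (z T) <= norm (minus (z T) (S0 T y))).
  { rewrite <- (Hiso T y) by lra.
    rewrite <- (norm_opp (minus (z T) (S0 T y))).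
    rewrite opp_minus. apply norm_minus_ge. }
  assert (HCI : Rabs c * I * exp (Rabs c * L * T) <= C * I).
  { unfold C. pose proof (exp_pos (Rabs c * L * T)). nra. }
  apply Rle_ge, Rmult_le_reg_l with (2 * C); [lra|].
  rewrite <- Rmult_assoc, Rinv_r by lra. lra.
Qed.
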